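(* For every integer $r\ge2$, \[ \mathscr{P}_{D_{r+2}}(q) = \mathscr{P}_{B_{r}}^H(q) + q^2 \mathscr{P}_{B_{r}}^{NH}(q) + (2q+2) \left( 2 \mathscr{P}_{B_{r}}^{NH}(q) - q^2 \sum_{i=1}^{r-1} \mathscr{P}_{B_{i}}^{NH}(q) \right). \]
   Context: A partition of a root $\tilde\alpha$ with $k$ parts is a multiset of $k$ positive roots (repetitions allowed) summing to $\tilde\alpha$. Type $B_n$ ($n\ge1$): with simple roots $\alpha_1,\dots,\alpha_n$, the positive roots are the nonhooked roots $\alpha_i+\cdots+\alpha_j$ ($1\le i\le j\le n$) and the hooked roots $\alpha_i+\cdots+\alpha_{j-1}+2\alpha_j+\cdots+2\alpha_n$ ($1\le i<j\le n$); the highest root is $\alpha_1+2\alpha_2+\cdots+2\alpha_n$ (equal to $\alpha_1$ if $n=1$). $\mathscr{P}^H_{B_n}(q)=\sum_k c_kq^k$ where $c_k$ is the number of partitions of the highest root of $B_n$ with $k$ parts at least one of which is a hooked root; $\mathscr{P}^{NH}_{B_n}(q)=\sum_k d_kq^k$ where $d_k$ is the number of partitions of the highest root of $B_n$ with $k$ parts none of which is hooked. Type $D_m$ ($m\ge4$): with simple roots $\alpha_1,\dots,\alpha_m$ ($\alpha_{m-2}$ the branch node adjacent to $\alpha_{m-3},\alpha_{m-1},\alpha_m$), the positive roots are $\alpha_i+\cdots+\alpha_j$ ($1\le i\le j\le m-1$), $\alpha_m$, $\alpha_i+\cdots+\alpha_{m-2}+\alpha_m$ ($1\le i\le m-2$),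 $\alpha_i+\cdots+\alpha_{m-2}+\alpha_{m-1}+\alpha_m$ ($1\le i\le m-2$), and $\alpha_i+\cdots+\alpha_{j-1}+2\alpha_j+\cdots+2\alpha_{m-2}+\alpha_{m-1}+\alpha_m$ ($1\le i<j\le m-2$); the highest root is $\alpha_1+2\alpha_2+\cdots+2\alpha_{m-2}+\alpha_{m-1}+\alpha_m$. $\mathscr{P}_{D_m}(q)=\sum_k a_kq^k$ where $a_k$ is the number of partitions of the highest root of $D_m$ with exactly $k$ parts. *)

(* Defs.v *)
From mathcomp Require Import all_boot all_order all_algebra.

Set Implicit Arguments.
Unset Strict Implicit.
Unset Printing Implicit Defensive.

Import GRing.Theory.

(* Coordinates in the basis of simple roots, numbered from 0: [a t] is the
   coefficient of alpha_(t+1). In types B and D the coefficients of a positive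
   root are at most 2; taking them in 'I_3 makes [rootvec n] a finite type. *)
Definition rootvec (n : nat) := {ffun 'I_n -> 'I_3}.

Section Partitions.
Variable n : nat.

(* A multiset of k roots is given by its multiplicity function, whose values
   are at most k and sum to k. *)
Definition kmultiset (k : nat) := {ffun rootvec n -> 'I_k.+1}.

Definition has_part k (m : kmultiset k) (a : rootvec n) : bool := 0 < m a.

Definition is_partition (Phi : pred (rootvec n)) (b : 'I_n -> nat)
    (k : nat) (m : kmultiset k) : bool :=
  [&& \sum_a m a == k,
      [forall a, has_part m a ==> Phi a] &
      [forall t, \sum_a m a * a t == b t]].

Definition num_partitions (Phi : pred (rootvec n)) (b : 'I_n -> nat)
    (Q : forall k, pred (kmultiset k)) (k : nat) : nat :=
  #|[set m : kmultiset k | is_partition Phi b m && Q k m]|.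

(* Generating polynomial of [num_partitions]. A partition of b into nonzero
   vectors has at most \sum_t b t parts, so no term is lost by the truncation;
   see [coef_partition_poly]. *)
Definition partition_poly (Phi : pred (rootvec n)) (b : 'I_n -> nat)
    (Q : forall k, pred (kmultiset k)) : {poly int} :=
  (\poly_(k < (\sum_t b t).+1) (num_partitions Phi b Q k)%:Z)%R.

Lemma partition_size (Phi : pred (rootvec n)) (b : 'I_n -> nat) k (m : kmultiset k) :
  (forall a, Phi a -> exists t, 0 < a t) ->
  is_partition Phi b m -> k <= \sum_t b t.
Proof.
move=> Phi_nz /and3P[/eqP card_m /forallP Phi_m /forallP sum_m].
rewrite -[leqLHS]card_m.
under [leqRHS]eq_bigr => t _ do rewrite -(eqP (sum_m t)).
rewrite exchange_big /=; apply: leq_sum => a _; rewrite -big_distrr /=.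
have [->|ma_gt0] := posnP (m a); first by [].
have [t at_gt0] := Phi_nz a (implyP (Phi_m a) ma_gt0).
by rewrite leq_pmulr // (bigD1 t) //= addn_gt0 at_gt0.
Qed.

Lemma coef_partition_poly (Phi : pred (rootvec n)) (b : 'I_n -> nat)
    (Q : forall k, pred (kmultiset k)) (k : nat) :
  (forall a, Phi a -> exists t, 0 < a t) ->
  ((partition_poly Phi b Q)`_k = (num_partitions Phi b Q k)%:Z)%R.
Proof.
move=> Phi_nz; rewrite coef_poly ltnS; case: leqP => // lt_bk.
rewrite /num_partitions (_ : [set _ | _] = set0) ?cards0 //.
apply/setP=> m; rewrite !inE; apply/negP => /andP[/(partition_size Phi_nz)].
by rewrite leqNgt lt_bk.
Qed.

End Partitions.

(* alpha_i + ... + alpha_j *)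
Definition nonhookedB n (a : rootvec n) : bool :=
  [exists i : 'I_n, exists j : 'I_n,
    (i <= j) && [forall t : 'I_n, a t == (i <= t <= j) :> nat]].

(* alpha_i + ... + alpha_(j-1) + 2 alpha_j + ... + 2 alpha_n *)
Definition hookedB n (a : rootvec n) : bool :=
  [exists i : 'I_n, exists j : 'I_n,
    (i < j) && [forall t : 'I_n, a t == (i <= t) + (j <= t) :> nat]].

Definition posrootB n (a : rootvec n) : bool := nonhookedB a || hookedB a.

Definition highestB n (t : 'I_n) : nat := 1 + (0 < t).

Definition some_hooked n k (m : kmultiset n k) : bool :=
  [exists a : rootvec n, has_part m a && hookedB a].

Definition PBH (n : nat) : {poly int} :=
  partition_poly (@posrootB n) (@highestB n) (@some_hooked n).

Definition PBNH (n : nat) : {poly int} :=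
  partition_poly (@posrootB n) (@highestB n) (fun k m => ~~ @some_hooked n k m).

(* With the numbering from 0, the branch node alpha_(m-2) has index m - 3, and
   alpha_(m-1), alpha_m have indices m - 2, m - 1. The five families are
     alpha_i + ... + alpha_j, j <= m - 1;
     alpha_m;
     alpha_i + ... + alpha_(m-2) + alpha_m;
     alpha_i + ... + alpha_(m-2) + alpha_(m-1) + alpha_m;
     alpha_i + ... + alpha_(j-1) + 2 alpha_j + ... + 2 alpha_(m-2)
       + alpha_(m-1) + alpha_m. *)
Definition posrootD m (a : rootvec m) : bool :=
  [|| [exists i : 'I_m, exists j : 'I_m,
        (i <= j < m - 1) && [forall t : 'I_m, a t == (i <= t <= j) :> nat]],
      [forall t : 'I_m, a t == (t == m - 1 :> nat) :> nat],
      [exists i : 'I_m, (i < m - 2) &&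
        [forall t : 'I_m, a t == (i <= t < m - 2) + (t == m - 1 :> nat) :> nat]],
      [exists i : 'I_m, (i < m - 2) &&
        [forall t : 'I_m, a t == (i <= t) :> nat]] |
      [exists i : 'I_m, exists j : 'I_m,
        (i < j < m - 2) &&
        [forall t : 'I_m, a t == (i <= t) + (j <= t < m - 2) :> nat]]].

Definition highestD m (t : 'I_m) : nat := 1 + (0 < t < m - 2).

Definition PD (m : nat) : {poly int} :=
  partition_poly (@posrootD m) (@highestD m) (fun k _ => true).

Lemma posrootB_neq0 n (a : rootvec n) : posrootB a -> exists t, 0 < a t.
Proof.
by case/orP=> /existsP[i /existsP[j /andP[lt_ij /forallP def_a]]];
  exists i; rewrite (eqP (def_a i)) leqnn ?lt_ij.
Qed.

Lemma posrootD_neq0 m (a : rootvec m) : 0 < m -> posrootD a -> exists t, 0 < a t.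
Proof.
move=> m_gt0; case/or4P => [||| /orP[]].
- case/existsP=> i /existsP[j /andP[/andP[le_ij _] /forallP def_a]].
  by exists i; rewrite (eqP (def_a i)) leqnn le_ij.
- have lt_m : m - 1 < m by rewrite ltn_subrL.
  by move/forallP/(_ (Ordinal lt_m))/eqP=> def_a; exists (Ordinal lt_m);
    rewrite def_a /= eqxx.
- by case/existsP=> i /andP[lt_i /forallP def_a];
    exists i; rewrite (eqP (def_a i)) leqnn lt_i.
- by case/existsP=> i /andP[lt_i /forallP def_a];
    exists i; rewrite (eqP (def_a i)) leqnn.
by case/existsP=> i /existsP[j /andP[_ /forallP def_a]];
  exists i; rewrite (eqP (def_a i)) leqnn.
Qed.

Lemma coef_PBH n k :
  ((PBH n)`_k = (num_partitions (@posrootB n) (@highestB n) (@some_hooked n) k)%:Z)%R.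
Proof. exact/coef_partition_poly/posrootB_neq0. Qed.

Lemma coef_PBNH n k :
  ((PBNH n)`_k = (num_partitions (@posrootB n) (@highestB n)
                    (fun k m => ~~ @some_hooked n k m) k)%:Z)%R.
Proof. exact/coef_partition_poly/posrootB_neq0. Qed.

Lemma coef_PD m k : 0 < m ->
  ((PD m)`_k = (num_partitions (@posrootD m) (@highestD m) (fun _ _ => true) k)%:Z)%R.
Proof. by move=> m_gt0; apply: coef_partition_poly => a; apply: posrootD_neq0. Qed.

(* Main.v *)
(** Split a partition of the highest root of D_(r+2) according to its parts
    meeting the two end nodes alpha_(r+1), alpha_(r+2). Either a single part
    contains both, or one part contains each; what remains is a partition of
    the highest root h of B_r, minus at most two suffixes
    e_i = alpha_i + ... + alpha_r, into intervals of alpha_1, ..., alpha_r.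
    Write N(v) for the generating polynomial of the partitions of v into
    intervals, M for the sum of N(h - e_i - e_j) over all ordered pairs (i, j),
    and H, NH for the two polynomials of B_r. Then H is q times the sum of
    N(h - e_i - e_j) over i < j, the sum of the N(h - e_i) is q M, and
    P_D = H + q^2 NH + (2 q + 2) q^2 M. On the other hand q^2 M is
    2 NH - q^2 sum_i N(h - 2 e_i), where N(h - 2 e_i) is NH for B_(i-1),
    and is 0 for i = 1. *)

Require Import Defs.
From mathcomp Require Import all_boot all_order all_algebra.
From mathcomp Require Import zify ring.

Import Order.TTheory GRing.Theory Num.Theory.
Local Open Scope ring_scope.

(** * Generating polynomials of multisets over a list, with bounded multiplicities *)

Section PartitionGeneratingPolynomial.
Context {G : zmodType}.
Implicit Types (s S A : seq G) (b p : G) (K : nat).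

Let lB (l : {additive G -> int}) b p : l (b - p) = l b - l p.
Proof. exact: raddfB. Qed.

Let lBMn (l : {additive G -> int}) b p c : l (b - p *+ c) = l b - l p *+ c.
Proof. by rewrite lB; congr (_ - _); exact: raddfMn. Qed.

(* Generating polynomial, by number of parts, of the multisets over the list [s]
   with sum [b] and all multiplicities less than [K]. *)
Fixpoint partgen K s b : {poly int} :=
  if s is p :: s' then \sum_(c < K) 'X^c * partgen K s' (b - p *+ c)
  else (b == 0)%:R.

(** Moving an entry past another only exchanges two sums over multiplicities. This frees the root
    lists from the order produced by [enum]. *)
Lemma perm_partgen K s1 s2 b : perm_eq s1 s2 -> partgen K s1 b = partgen K s2 b.
Proof.
have mid p s s' b' : partgen K (p :: s ++ s') b' = partgen K (s ++ p :: s') b'.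
  elim: s b' => //= x s IHs b'.
  under [RHS]eq_bigr => c _ do rewrite -IHs /= big_distrr.
  under [LHS]eq_bigr => c _ do rewrite big_distrr.
  rewrite exchange_big; apply: eq_bigr => i _; apply: eq_bigr => j _ /=.
  by rewrite mulrCA addrAC.
elim: s1 s2 b => [|p s1 IHs] s2 b; first by rewrite perm_sym => /perm_nilP->.
move=> eq_s; have : p \in s2 by rewrite -(perm_mem eq_s) mem_head.
move=> ps2; case: (path.splitPr ps2) eq_s => s2' s3 eq_s {ps2 s2}.
rewrite -mid /=; apply: eq_bigr => c _; rewrite (IHs (s2' ++ s3)) //.
by rewrite -(perm_cons p) (perm_trans eq_s) // -cat1s perm_catCA.
Qed.

(** A multiplicity above [k] contributes only to powers of ['X] beyond [k], so any bound exceeding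
    [k] gives the same coefficient. *)
Lemma coef_partgen K1 K2 s b k : (k < K1)%N -> (k < K2)%N ->
  (partgen K1 s b)`_k = (partgen K2 s b)`_k.
Proof.
elim: s b k K1 K2 => //= p s IHs b k K1 K2 ltk1 ltk2.
(* The right-hand side does not mention [K], so it serves as common value for both bounds. *)
suff H K : (k < K)%N -> (\sum_(c < K) 'X^c * partgen K s (b - p *+ c))`_k =
    \sum_(c < k.+1) (partgen k.+1 s (b - p *+ c))`_(k - c).
  by rewrite !H.
move=> ltkK; rewrite coef_sum.
rewrite (big_ord_widen _ (fun c => (partgen k.+1 s (b - p *+ c))`_(k - c)) ltkK).
rewrite [RHS]big_mkcond; apply: eq_bigr => c _; rewrite coefXnM ltnS ltnNge.
by case: leqP => //= lek; apply: IHs; lia.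
Qed.

(** An additive functional [l] acts as a weight: parts of nonnegative weight cannot add up to a
    negative one. The weights used later are the coordinates [coefp t]. *)
Lemma partgen_lt0 {l : {additive G -> int}} {K s b} :
  {in s, forall p, 0 <= l p} -> l b < 0 -> partgen K s b = 0.
Proof.
elim: s b => [|p s IHs] b l_ge0 lb /=.
  by have [b0|//] := eqVneq b 0; move: lb; rewrite b0 raddf0 ltxx.
apply: big1 => c _; rewrite IHs ?mulr0 // => [x xs|].
  by rewrite l_ge0 // inE xs orbT.
rewrite lBMn (le_lt_trans _ lb) // gerBl mulrn_wge0 //.
by rewrite l_ge0 // mem_head.
Qed.

Lemma partgen_neq0 {l : {additive G -> int}} {K s b} :
  {in s, forall p, l p = 0} -> l b != 0 -> partgen K s b = 0.
Proof.
elim: s b => [|p s IHs] b l_eq0 lb /=.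
  by have [b0|//] := eqVneq b 0; move: lb; rewrite b0 raddf0 eqxx.
apply: big1 => c _; rewrite IHs ?mulr0 // => [x xs|].
  by rewrite l_eq0 // inE xs orbT.
by rewrite lBMn (l_eq0 p) ?mem_head // mul0rn subr0.
Qed.

Lemma partgen3_cons p s b :
  partgen 3 (p :: s) b = partgen 3 s b + 'X * partgen 3 s (b - p)
    + 'X^2 * partgen 3 s (b - p *+ 2).
Proof.
rewrite /= !big_ord_recl big_ord0 /= /bump /=.
by rewrite expr0 expr1 mul1r mulr0n subr0 mulr1n addr0 addrA.
Qed.

(** Two parts from [S] would already weigh [d *+ 2], more than [b], and parts from [A] cannot
    compensate. Hence at most one part comes from [S], and it occurs once. *)
Lemma partgen_cat_once {l : {additive G -> int}} {d : int} {S A b} :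
    {in S, forall p, l p = d} -> {in A, forall p, 0 <= l p} -> 0 <= d ->
    l b < d *+ 2 ->
  partgen 3 (S ++ A) b = partgen 3 A b + 'X * \sum_(p <- S) partgen 3 A (b - p).
Proof.
move=> lS lA d_ge0.
have out S' b' : {subset S' <= S} -> l b' < 0 -> partgen 3 (S' ++ A) b' = 0.
  move=> sS' lb'; apply: (@partgen_lt0 l) => // p.
  by rewrite mem_cat => /orP[/sS'/lS->|/lA].
(* Once less than [d] of the weight is left, no further part from [S] fits. *)
have skip S' b' : {subset S' <= S} -> l b' < d ->
    partgen 3 (S' ++ A) b' = partgen 3 A b'.
  elim: S' => // p S' IHS sS' lb'; rewrite [_ ++ _]/= partgen3_cons.
  have lp : l p = d by rewrite lS // sS' // mem_head.
  have sS : {subset S' <= S} by move=> x xS'; rewrite sS' // inE xS' orbT.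
  rewrite IHS // !out ?mulr0 ?addr0 // ?lBMn ?lB lp; lia.
have : {subset S <= S} by [].
elim: {-2}S => [|p S' IHS] sS' lb; first by rewrite big_nil mulr0 addr0.
have lp : l p = d by rewrite lS // sS' // mem_head.
have sS : {subset S' <= S} by move=> x xS'; rewrite sS' // inE xS' orbT.
rewrite [_ ++ _]/= partgen3_cons IHS // skip //; last by rewrite lB lp; lia.
rewrite [X in _ + 'X^2 * X]out //; last by rewrite lBMn lp; lia.
by rewrite big_cons mulr0 addr0 mulrDr -addrA [X in _ + X]addrC.
Qed.

Lemma partgen_cat_none {l : {additive G -> int}} {S A b} :
    {in S, forall p, l p = 1} -> {in A, forall p, l p = 0} -> l b = 0 ->
  partgen 3 (S ++ A) b = partgen 3 A b.
Proof.
move=> lS lA lb; rewrite (partgen_cat_once lS) ?lb // => [|p /lA->//].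
rewrite big_seq big1 ?mulr0 ?addr0 // => p pS.
by rewrite (partgen_neq0 lA) // lB lb lS.
Qed.

Lemma partgen_cat_one {l : {additive G -> int}} {S A b} :
    {in S, forall p, l p = 1} -> {in A, forall p, l p = 0} -> l b = 1 ->
  partgen 3 (S ++ A) b = 'X * \sum_(p <- S) partgen 3 A (b - p).
Proof.
move=> lS lA lb; rewrite (partgen_cat_once lS) ?lb // => [|p /lA->//].
by rewrite (partgen_neq0 lA) ?lb ?add0r.
Qed.

(* Doubling turns the sum over unordered pairs of parts into a sum over ordered
   pairs plus a diagonal correction. *)
Lemma partgen_cat_two {l : {additive G -> int}} {S A b} :
    {in S, forall p, l p = 1} -> {in A, forall p, l p = 0} -> l b = 2 ->
  2 * partgen 3 (S ++ A) b =
    'X^2 * (\sum_(p <- S) \sum_(p' <- S) partgen 3 A (b - p - p')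
            + \sum_(p <- S) partgen 3 A (b - p *+ 2)).
Proof.
move=> + lA lb; elim: S => [|p S IHS] lS.
  by rewrite !big_nil addr0 mulr0 (partgen_neq0 lA) ?lb ?mulr0.
have lp : l p = 1 by rewrite lS // mem_head.
have lS' : {in S, forall x, l x = 1} by move=> x xS; rewrite lS // inE xS orbT.
rewrite [_ ++ _]/= partgen3_cons !mulrDr IHS // !big_cons.
under [\sum_(i <- S) \sum_(j <- p :: S) _]eq_bigr => i _ do rewrite big_cons.
rewrite big_split /= (partgen_cat_one lS' lA); last by rewrite lB lp lb.
rewrite (partgen_cat_none lS' lA); last by rewrite lBMn lp lb.
under [\sum_(i <- S) partgen 3 A (b - i - p)]eq_bigr => i _ do rewrite addrAC.
rewrite mulr2n opprD addrA.
by ring.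
Qed.

(** Some functional in [L] is at least 1 on [p] and at most 2 on [b], so three copies of [p] leave a
    negative weight, which the remaining parts cannot make up. *)
Lemma partgen_mult_bound (L : {additive G -> int} -> Prop) K s b : (2 < K)%N ->
    {in s, forall p, forall l, L l -> 0 <= l p} ->
    {in s, forall p, exists2 l, L l & 0 < l p} ->
    (forall l, L l -> l b <= 2) ->
  partgen K s b = partgen 3 s b.
Proof.
move=> K_gt2; elim: s b => //= p s IHs b L_ge0 L_gt0 Lb.
have ps : p \in p :: s by exact: mem_head.
have ss : {subset s <= p :: s} by move=> x xs; rewrite inE xs orbT.
have Lge0 : {in s, forall p, forall l, L l -> 0 <= l p} by move=> x /ss/L_ge0.
have Lgt0 : {in s, forall p, exists2 l, L l & 0 < l p} by move=> x /ss/L_gt0.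
have [l Ll lp] := L_gt0 p ps.
rewrite (big_ord_widen _ (fun c => 'X^c * partgen 3 s (b - p *+ c)) K_gt2).
rewrite [RHS]big_mkcond; apply: eq_bigr => c _.
rewrite IHs // => [|l' Ll']; last first.
  by rewrite lBMn (le_trans _ (Lb _ Ll')) // gerBl mulrn_wge0 ?L_ge0.
case: ltnP => // c_gt2; rewrite (@partgen_lt0 l) ?mulr0 // => [x xs|].
  exact: Lge0.
have := Lb l Ll; rewrite lBMn; nia.
Qed.

End PartitionGeneratingPolynomial.

(** * Comparison with the counting definition [partition_poly] *)

Lemma partgen_multisets (G : zmodType) (T : finType) (w : T -> G) K s b :
  uniq s ->
  partgen K.+1 (map w s) b =
    \sum_(m : {ffun T -> 'I_K.+1} | [forall a, (0 < m a)%N ==> (a \in s)])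
      if \sum_a w a *+ m a == b then 'X^(\sum_a m a) else 0.
Proof.
elim: s b => [|p s IHs] b /=.
  move=> _; rewrite (big_pred1 [ffun=> ord0]) => [|m]; last first.
    apply/forallP/eqP=> [m0|-> a]; last by rewrite ffunE.
    apply/ffunP=> a; rewrite ffunE; apply/val_inj/eqP.
    by have := m0 a; rewrite in_nil implybF -eqn0Ngt.
  under eq_bigr => a _ do rewrite ffunE mulr0n.
  under [X in 'X^X]eq_bigr => a _ do rewrite ffunE.
  by rewrite !big1 // eq_sym; case: eqP.
move=> /andP[pNs uniq_s].
rewrite [RHS](partition_big (fun m : {ffun T -> _} => m p) predT) //=.
apply: eq_bigr => c _; rewrite IHs // big_distrr /=.
(* [h c] and [h ord0] are inverse bijections between the multisets supported on [s] and those
   supported on [p :: s] with multiplicity [c] at [p]. *)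
pose h (d : 'I_K.+1) (m : {ffun T -> 'I_K.+1}) :=
  [ffun a => if a == p then d else m a].
rewrite [RHS](reindex_onto (h c) (h ord0)) => [|m /andP[_ /eqP mp]]; last first.
  by apply/ffunP=> a; rewrite !ffunE; case: eqP => [->|].
have m0P (m : {ffun T -> 'I_K.+1}) : [forall a, (0 < m a)%N ==> (a \in s)] -> m p = ord0.
  move/forallP/(_ p); rewrite (negPf pNs) implybF -eqn0Ngt => /eqP mp.
  exact: val_inj.
apply: eq_big => [m|m /m0P mp].
  rewrite [h c m p]ffunE eqxx eqxx andbT; apply/idP/andP => [mP|[/forallP mP /eqP hm]].
    split; last first.
      by apply/eqP/ffunP=> a; rewrite !ffunE; case: eqP => // ->; rewrite m0P.
    apply/forallP=> a; rewrite ffunE inE; case: eqP => [_|_] /=.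
      exact: implybT.
    exact: (forallP mP).
  apply/forallP=> a; have := mP a; rewrite -{2}hm !ffunE inE.
  by case: eqP => //= _; rewrite implyFb.
have sumE (V : zmodType) (F : T -> V) :
    \sum_a F a *+ h c m a = F p *+ c + \sum_a F a *+ m a.
  rewrite (bigD1 p) //= [in RHS](bigD1 p) //= mp mulr0n add0r ffunE eqxx.
  by congr (_ + _); apply: eq_bigr => a /negPf ap; rewrite ffunE ap.
rewrite sumE.
have -> : (\sum_a w a *+ m a == b - w p *+ c) = (w p *+ c + \sum_a w a *+ m a == b).
  by rewrite eq_sym subr_eq addrC eq_sym.
have -> : (\sum_a h c m a = c + \sum_a m a)%N.
  rewrite (bigD1 p) //= [in RHS](bigD1 p) //= mp add0n ffunE eqxx.
  by congr (_ + _)%N; apply: eq_bigr => a /negPf ap; rewrite ffunE ap.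
by case: eqP; rewrite ?mulr0 // exprD.
Qed.

(* Vectors of all lengths live in {poly int}, with alpha_(t+1) encoded as 'X^t, so
   that B_i, B_r and D_(r+2) share one ambient group. *)
Definition rootpoly {n} (a : rootvec n) : {poly int} :=
  \poly_(t < n) (oapp (fun t => a t : nat) 0%N (insub t))%:Z.

Lemma coef_rootpoly n (a : rootvec n) (t : 'I_n) : (rootpoly a)`_t = (a t)%:Z.
Proof. by rewrite coef_poly ltn_ord valK. Qed.

Lemma eq_rootpoly n (a : rootvec n) (x : {poly int}) : (size x <= n)%N ->
  (rootpoly a == x) = [forall t : 'I_n, (a t)%:Z == x`_t].
Proof.
move=> szx; apply/eqP/forallP => [<- t|eq_ax]; first by rewrite coef_rootpoly.
apply/polyP=> t; have [ltn|len] := ltnP t n.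
  by have := eq_ax (Ordinal ltn); rewrite -coef_rootpoly /= => /eqP.
by rewrite coef_poly ltnNge len nth_default // (leq_trans szx).
Qed.

Lemma rootpoly_inj {n} : injective (@rootpoly n).
Proof.
move=> a a' eq_aa'; apply/ffunP=> t; apply/val_inj/eqP.
by rewrite -eqz_nat -!coef_rootpoly eq_aa'.
Qed.

(** Bridge from counting to [partgen], with [L] listing the encoded roots. The bound 2 on the
    coordinates of [b] is what allows multiplicities to stop below 3. *)
Lemma partition_polyE n (Phi : pred (rootvec n)) (b : 'I_n -> nat)
    (L : seq {poly int}) (bp : {poly int}) :
    (forall a, Phi a -> exists t, (0 < a t)%N) ->
    (forall t, b t <= 2)%N ->
    (size bp <= n)%N -> (forall t : 'I_n, bp`_t = (b t)%:Z) ->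
    uniq L ->
    (forall x, x \in L -> (size x <= n)%N /\ forall t : 'I_n, 0 <= x`_t <= 2) ->
    (forall a, Phi a = (rootpoly a \in L)) ->
  partition_poly Phi b (fun _ _ => true) = partgen 3 L bp.
Proof.
move=> Phi_nz b_le2 szb bpE uniqL LP PhiE.
have permL : perm_eq (map rootpoly (enum Phi)) L.
  apply: uniq_perm => // [|x]; first by rewrite (map_inj_uniq rootpoly_inj) enum_uniq.
  apply/mapP/idP => [[a + ->]|xL]; first by rewrite mem_enum /in_mem /= PhiE.
  have [szx xP] := LP x xL.
  (* The coordinates of [x] lie between 0 and 2, so [absz] and [inord] lose nothing and [a] is a
     preimage of [x]. *)
  pose a : rootvec n := [ffun t : 'I_n => inord (absz x`_t)].
  suff xa : x = rootpoly a.
    by exists a => //; rewrite mem_enum /in_mem /= PhiE -xa.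
  apply/esym/eqP; rewrite eq_rootpoly //; apply/forallP=> t.
  by have := xP t; rewrite ffunE; case: (x`_t) => [k|//] /andP[_ k2]; rewrite inordK.
apply/polyP=> k; rewrite coef_partition_poly // -(perm_partgen _ _ _ _ permL).
(* The bound [k.+3] exceeds both 2 and [k], so it links the bound 3 to the bound [k.+1] built into
   [kmultiset]. *)
have -> : partgen 3 (map rootpoly (enum Phi)) bp
        = partgen k.+3 (map rootpoly (enum Phi)) bp.
  apply/esym/(partgen_mult_bound (fun l => exists t : 'I_n, l =1 coefp t)) => //.
  - by move=> _ /mapP[a _ ->] l [t ->]; rewrite /= coef_rootpoly.
  - move=> _ /mapP[a + ->]; rewrite mem_enum => /Phi_nz[t at_gt0].
    by exists (coefp t); [exists t | rewrite /= coef_rootpoly].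
  - by move=> l [t ->]; rewrite /= bpE lez_nat.
have ltk3 : (k < k.+3)%N by lia.
rewrite (coef_partgen _ k.+1) // partgen_multisets ?enum_uniq //.
rewrite coef_sum /num_partitions -[LHS]natz -sum1dep_card natr_sum.
rewrite [LHS]big_mkcond [RHS]big_mkcond; apply: eq_bigr => m _ /=.
rewrite andbT /is_partition.
have -> : [forall a, has_part m a ==> Phi a] =
          [forall a, (0 < m a)%N ==> (a \in enum Phi)].
  by apply: eq_forallb => a; rewrite mem_enum.
have -> : [forall t, (\sum_a m a * a t)%N == b t] =
          (\sum_a rootpoly a *+ m a == bp).
  have coefE (t : 'I_n) : (\sum_a rootpoly a *+ m a)`_t = (\sum_a m a * a t)%N%:Z.
    rewrite coef_sum -natz natr_sum; apply: eq_bigr => a _.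
    by rewrite coefMn coef_rootpoly -[LHS]mulr_natr !natz mulnC PoszM.
  apply/forallP/eqP => [eqb|eqb t]; last by rewrite -eqz_nat -bpE -eqb coefE.
  apply/polyP=> t; have [ltn|len] := ltnP t n.
    by have := eqb (Ordinal ltn); rewrite -eqz_nat -coefE -bpE => /eqP.
  rewrite nth_default; first by rewrite nth_default // (leq_trans szb).
  apply: (leq_trans _ len); apply: (leq_trans (size_sum _ _ _)).
  apply/bigmax_leqP => a _; rewrite -scaler_nat.
  exact: leq_trans (size_scale_leq _ _) (size_poly _ _).
rewrite andbC -andbA.
case: [forall a, _] => //=; case: (_ == bp); last by rewrite coef0.
by rewrite coefXn eq_sym; case: eqP.
Qed.

(** * Roots and partitions in type B *)

(* alpha_(i+1) + ... + alpha_n *)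
Definition ivl n i : {poly int} := \poly_(t < n) (i <= t)%N%:Z.

Lemma coef_ivl n i t : (ivl n i)`_t = (i <= t < n)%N%:Z.
Proof. by rewrite coef_poly andbC; case: (t < n)%N. Qed.

Lemma size_ivl n i : (size (ivl n i) <= n)%N.
Proof. exact: size_poly. Qed.

Lemma ivl_inj n i j : (i < n)%N -> (j < n)%N -> ivl n i = ivl n j -> i = j.
Proof.
move=> ltin ltjn /polyP eq_ij.
have := eq_ij i; have := eq_ij j; rewrite !coef_ivl; lia.
Qed.

Definition suffixes n := [seq ivl n i | i <- iota 0 n].

(** Grouping intervals by their right end puts those through the last node in front, where the
    [partgen_cat] lemmas can split them off. *)
Fixpoint intervals n :=
  if n is n'.+1 then suffixes n ++ intervals n' else [::].

Lemma intervalsS n : intervals n.+1 = suffixes n.+1 ++ intervals n.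
Proof. by []. Qed.

(** Two suffixes with different starts overlap in the shorter one, which produces the coefficients 2
    of a hooked root. *)
Definition hooks n :=
  [seq ivl n i + ivl n j | j <- iota 0 n, i <- iota 0 j].

Definition topB n : {poly int} := \poly_(t < n) (1 + (0 < t))%N%:Z.

Lemma coef_topB n t : (topB n)`_t = ((t < n) * (1 + (0 < t)))%N%:Z.
Proof. by rewrite coef_poly; case: (t < n)%N; rewrite ?mul1n. Qed.

Lemma suffixesP n x :
  reflect (exists2 i, (i < n)%N & x = ivl n i) (x \in suffixes n).
Proof.
apply: (iffP mapP) => [[i + ->]|[i lti ->]].
  by rewrite mem_iota => /andP[_]; exists i.
by exists i => //; rewrite mem_iota.
Qed.

Lemma intervalsP n x :
  reflect (exists i k, (i < k <= n)%N /\ x = ivl k i) (x \in intervals n).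
Proof.
elim: n => [|n IHn]; first by constructor=> -[i [k []]]; lia.
rewrite intervalsS mem_cat; apply: (iffP orP) => [[/suffixesP[i lti ->]|/IHn[i [k [ltik ->]]]]|].
- by exists i, n.+1; split; [lia|].
- by exists i, k; split; [lia|].
- case=> i [k [ltik xE]]; have [kn|kn] := eqVneq k n.+1.
    by left; apply/suffixesP; exists i; rewrite -?kn //; case/andP: ltik.
  by right; apply/IHn; exists i, k; split; [lia|].
Qed.

Lemma hooksP n x :
  reflect (exists i j, (i < j < n)%N /\ x = ivl n i + ivl n j) (x \in hooks n).
Proof.
apply: (iffP allpairsPdep) => [[j [i [+ + ->]]]|[i [j [ltij ->]]]].
  by rewrite !mem_iota => ltj lti; exists i, j; split; [lia|].
by exists j, i; rewrite !mem_iota; split => //; lia.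
Qed.

Lemma suffixes_uniq n : uniq (suffixes n).
Proof.
rewrite map_inj_in_uniq ?iota_uniq // => i j; rewrite !mem_iota => lti ltj.
by apply: ivl_inj; lia.
Qed.

Lemma intervals_coef_ge n t x : (n <= t)%N -> x \in intervals n -> x`_t = 0.
Proof. by move=> lent /intervalsP[i [k [ltik ->]]]; rewrite coef_ivl; lia. Qed.

Lemma suffixes_coef_last n x : x \in suffixes n -> x`_n.-1 = 1.
Proof. by case/suffixesP=> i lti ->; rewrite coef_ivl; lia. Qed.

Lemma hooks_coef_last n x : x \in hooks n -> x`_n.-1 = 2.
Proof. by case/hooksP=> i [j [ltij ->]]; rewrite coefD !coef_ivl; lia. Qed.

Lemma intervals_uniq n : uniq (intervals n).
Proof.
elim: n => // n IHn; rewrite intervalsS cat_uniq suffixes_uniq IHn andbT.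
apply/hasPn => x xn; apply/negP=> /suffixes_coef_last /=.
by rewrite (@intervals_coef_ge n).
Qed.

Lemma hooks_uniq n : uniq (hooks n).
Proof.
apply: allpairs_uniq_dep => [|j _|[j i] [j' i']]; rewrite ?iota_uniq //.
case/allpairsPdep=> j1 [i1 []]; rewrite !mem_iota => ltj lti [-> ->].
case/allpairsPdep=> j2 [i2 []]; rewrite !mem_iota => ltj' lti' [-> ->] /= /polyP eq_ij.
(* A hook jumps from 0 to 1 and from 1 to 2 at its two starts, so comparing both hooks at all four
   starts identifies them. *)
have := eq_ij i1; have := eq_ij i2; have := eq_ij j1; have := eq_ij j2.
rewrite !coefD !coef_ivl => h1 h2 h3 h4.
have -> : i1 = i2 by lia.
have -> : j1 = j2 by lia.
by [].
Qed.

Lemma hooks_intervals_disjoint n x : x \in hooks n -> x \notin intervals n.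
Proof.
move=> /hooks_coef_last xl; apply/negP => /intervalsP[i [k [_ xE]]].
by move: xl; rewrite xE coef_ivl; lia.
Qed.

Lemma nonhookedBE n (a : rootvec n) :
  nonhookedB a = (rootpoly a \in intervals n).
Proof.
apply/idP/intervalsP => [/existsP[i /existsP[j /andP[leij aE]]]|[i [k [ltik /eqP]]]].
  (* The right end of [ivl] is exclusive, hence [j.+1] here and [k.-1] in the converse. *)
  exists i, j.+1; split; first by have := ltn_ord j; lia.
  apply/eqP; rewrite eq_rootpoly; last first.
    by apply: leq_trans (size_ivl _ _) _; have := ltn_ord j; lia.
  by apply/forallP=> t; rewrite (eqP (forallP aE t)) coef_ivl ltnS.
rewrite eq_rootpoly => [/forallP aE|]; last by apply: leq_trans (size_ivl _ _) _; lia.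
have lti : (i < n)%N by lia.
have ltk : (k.-1 < n)%N by lia.
apply/existsP; exists (Ordinal lti); apply/existsP; exists (Ordinal ltk) => /=.
apply/andP; split; first lia.
apply/forallP=> t; have := aE t; rewrite coef_ivl eqz_nat => /eqP->.
by apply/eqP; congr (nat_of_bool (_ && _)); lia.
Qed.

Lemma hookedBE n (a : rootvec n) : hookedB a = (rootpoly a \in hooks n).
Proof.
have szh i j : (size (ivl n i + ivl n j)%R <= n)%N.
  by apply: leq_trans (size_polyD _ _) _; rewrite geq_max !size_ivl.
apply/idP/hooksP => [/existsP[i /existsP[j /andP[leij aE]]]|[i [j [ltij /eqP]]]].
  exists i, j; split; first by have := ltn_ord j; lia.
  apply/eqP; rewrite eq_rootpoly //.
  apply/forallP=> t; rewrite (eqP (forallP aE t)) coefD !coef_ivl ltn_ord.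
  by rewrite !andbT PoszD.
rewrite eq_rootpoly // => /forallP aE.
have lti : (i < n)%N by lia.
have ltj : (j < n)%N by lia.
apply/existsP; exists (Ordinal lti); apply/existsP; exists (Ordinal ltj) => /=.
apply/andP; split; first lia.
apply/forallP=> t; have := aE t.
by rewrite coefD !coef_ivl ltn_ord !andbT -PoszD eqz_nat.
Qed.

(** Hooks and intervals are disjoint, so forbidding hooked parts leaves exactly the partitions into
    intervals. *)
Lemma PBNHE n : PBNH n = partgen 3 (intervals n) (topB n).
Proof.
rewrite -(@partition_polyE n (@nonhookedB n) (@highestB n)).
- apply: eq_poly => k _; congr (Posz #|pred_of_set _|).
  apply/setP=> m; rewrite !inE andbT /is_partition -!andbA.
  case: (_ == k) => //=; rewrite andbCA [RHS]andbC; case: [forall t, _] => //=.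
  apply/andP/forallP => [[/forallP mP /existsPn noh] a|mP]; last split.
  + apply/implyP=> ma; have := implyP (mP a) ma; rewrite /posrootB.
    by have := noh a; rewrite ma /= => /negPf->; rewrite orbF.
  + by apply/forallP=> a; apply/implyP=> /(implyP (mP a)); rewrite /posrootB => ->.
  + apply/existsPn => a; apply/negP=> /andP[ma]; have := implyP (mP a) ma.
    by rewrite hookedBE nonhookedBE => ? /hooks_intervals_disjoint/negP.
- by move=> a na; apply: posrootB_neq0; rewrite /posrootB na.
- by move=> t; rewrite /highestB; case: (0 < t)%N.
- exact: size_poly.
- by move=> t; rewrite coef_topB ltn_ord mul1n.
- exact: intervals_uniq.
- move=> x /intervalsP[i [k [ltik ->]]]; split.
    by apply: leq_trans (size_ivl _ _) _; lia.
  by move=> t; rewrite coef_ivl; case: (i <= t < k)%N.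
- exact: nonhookedBE.
Qed.

(** [partgen] records which parts are allowed, not that some part must occur; adding [PBNH n]
    removes that requirement. *)
Lemma PBHE n : PBH n + PBNH n = partgen 3 (hooks n ++ intervals n) (topB n).
Proof.
rewrite -(@partition_polyE n (@posrootB n) (@highestB n)).
- apply/polyP=> k; rewrite coefD coef_PBH coef_PBNH coef_partition_poly;
    last exact: posrootB_neq0.
  rewrite -PoszD; congr Posz; rewrite /num_partitions.
  rewrite -[RHS](cardsID [set m | some_hooked m]); congr (_ + _)%N.
    by apply: eq_card => m; rewrite !inE andbT.
  by apply: eq_card => m; rewrite !inE andbT andbC.
- exact: posrootB_neq0.
- by move=> t; rewrite /highestB; case: (0 < t)%N.
- exact: size_poly.
- by move=> t; rewrite coef_topB ltn_ord mul1n.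
- rewrite cat_uniq hooks_uniq intervals_uniq andbT /=; apply/hasPn => x.
  by apply: contraTN => /hooks_intervals_disjoint.
- move=> x; rewrite mem_cat => /orP[/hooksP[i [j [_ ->]]]|/intervalsP[i [k [ltik ->]]]]; split.
  + by apply: leq_trans (size_polyD _ _) _; rewrite geq_max !size_ivl.
  + by move=> t; rewrite coefD !coef_ivl; case: (i <= t < n)%N; case: (j <= t < n)%N.
  + by apply: leq_trans (size_ivl _ _) _; lia.
  + by move=> t; rewrite coef_ivl; case: (i <= t < k)%N.
- by move=> a; rewrite mem_cat /posrootB nonhookedBE hookedBE orbC.
Qed.

(** * Roots of D_(r+2) and reduction to intervals of alpha_1, ..., alpha_r *)

Lemma coefXnz n t : ('X^n : {poly int})`_t = (t == n)%:Z.
Proof. by rewrite coefXn natz. Qed.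

Lemma size_suffixes n x : x \in 0 :: suffixes n -> (size x <= n)%N.
Proof.
rewrite inE => /predU1P[->|/suffixesP[i _ ->]]; first by rewrite size_poly0.
exact: size_ivl.
Qed.

Lemma size_hooks n x : x \in hooks n -> (size x <= n)%N.
Proof.
case/hooksP=> i [j [_ ->]].
by apply: leq_trans (size_polyD _ _) _; rewrite geq_max !size_ivl.
Qed.

(* [ivl n n] is the zero polynomial. *)
Lemma suffixes0P n x :
  reflect (exists2 i, (i <= n)%N & x = ivl n i) (x \in 0 :: suffixes n).
Proof.
have ivl0 : ivl n n = 0 by apply/polyP=> t; rewrite coef_ivl coef0; lia.
rewrite inE; apply: (iffP predU1P) => [[->|/suffixesP[i lti ->]]|[i lei ->]].
- by exists n.
- by exists i; [exact: ltnW|].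
- have [->|ltin] := eqVneq i n; first by left.
  by right; apply/suffixesP; exists i => //; lia.
Qed.

(* The positive roots of D_(r+2) containing both end nodes, only alpha_(r+1), and
   only alpha_(r+2). *)
Definition rootsD_both r : seq {poly int} :=
  [seq s + ('X^r + 'X^(r.+1)) | s <- suffixes r ++ hooks r].
Definition rootsD_left r : seq {poly int} :=
  [seq s + 'X^r | s <- 0 :: suffixes r].
Definition rootsD_right r : seq {poly int} :=
  [seq s + 'X^(r.+1) | s <- 0 :: suffixes r].
Definition topD r : {poly int} := topB r + ('X^r + 'X^(r.+1)).

Lemma rootsD_bothP r x : x \in rootsD_both r ->
  exists2 s : {poly int}, (size s <= r)%N /\ (forall t, 0 <= s`_t <= 2) &
    x = s + ('X^r + 'X^(r.+1)).
Proof.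
case/mapP=> s; rewrite mem_cat => sP ->; exists s => //.
case/orP: sP => sP; split=> [|t].
- by apply: size_suffixes; rewrite inE sP orbT.
- by case/suffixesP: sP => i _ ->; rewrite coef_ivl; lia.
- exact: size_hooks.
- by case/hooksP: sP => i [j [_ ->]]; rewrite coefD !coef_ivl; lia.
Qed.

Lemma rootsD_both_coef r x : x \in rootsD_both r -> x`_r = 1 /\ x`_r.+1 = 1.
Proof.
case/rootsD_bothP=> s [szs _] ->; rewrite !coefD !coefXnz.
by rewrite !nth_default ?(leqW szs) //; split; lia.
Qed.

Lemma rootsD_left_coef r x : x \in rootsD_left r -> x`_r = 1 /\ x`_r.+1 = 0.
Proof.
case/mapP=> s /suffixes0P[i _ ->] ->.
by rewrite !coefD !coefXnz !coef_ivl; split; lia.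
Qed.

Lemma rootsD_right_coef r x : x \in rootsD_right r -> x`_r = 0 /\ x`_r.+1 = 1.
Proof.
case/mapP=> s /suffixes0P[i _ ->] ->.
by rewrite !coefD !coefXnz !coef_ivl; split; lia.
Qed.

(** The coordinates at the two end nodes are (1,1), (1,0), (0,1), (0,0) on the four lists, which
    separates them. Within the first, suffixes and hooks differ at index [r.-1]. *)
Lemma rootsD_uniq r :
  uniq ((rootsD_both r ++ rootsD_left r) ++ rootsD_right r ++ intervals r).
Proof.
have uniq_suff : uniq (0 :: suffixes r).
  rewrite /= suffixes_uniq andbT; apply/negP=> /suffixes_coef_last.
  by rewrite coef0.
have uniqD (c : {poly int}) s : uniq s -> uniq [seq x + c | x <- s].
  by rewrite map_inj_uniq //; exact: addIr.
have uniqB : uniq (rootsD_both r).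
  rewrite uniqD // cat_uniq suffixes_uniq hooks_uniq andbT /=.
  apply/hasPn=> x /hooks_coef_last xl.
  by apply/negP=> /suffixes_coef_last; rewrite xl.
rewrite !cat_uniq uniqB [uniq (rootsD_left r)]uniqD //.
rewrite [uniq (rootsD_right r)]uniqD // intervals_uniq !andTb !andbT.
apply/and3P; split; apply/hasPn => x xP; apply/negP.
- case/rootsD_left_coef: xP => _ x0.
  by case/rootsD_both_coef=> _; rewrite x0.
- rewrite mem_cat; move: xP; rewrite mem_cat => /orP[/rootsD_right_coef[x0 _]|xI].
    by case/orP=> [/rootsD_both_coef|/rootsD_left_coef] [+ _]; rewrite x0.
  have x0 := intervals_coef_ge _ _ _ (leqnn r) xI.
  by case/orP=> [/rootsD_both_coef|/rootsD_left_coef] [+ _]; rewrite x0.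
- have x0 := intervals_coef_ge _ _ _ (leqnSn r) xP.
  by case/rootsD_right_coef=> _; rewrite x0.
Qed.

Lemma rootsD_bounds r x :
    x \in (rootsD_both r ++ rootsD_left r) ++ rootsD_right r ++ intervals r ->
  (size x <= r.+2)%N /\ forall t : 'I_r.+2, 0 <= x`_t <= 2.
Proof.
rewrite !mem_cat -orbA => /or4P[].
- case/rootsD_bothP=> s [szs sP] ->; split.
    apply/leq_sizeP => t ltt; rewrite !coefD !coefXnz nth_default; first lia.
    exact: leq_trans szs (ltnW (ltnW ltt)).
  move=> t; rewrite !coefD !coefXnz; have := sP t.
  have [ltr|ler] := ltnP t r; first by lia.
  by rewrite nth_default; [lia|exact: leq_trans szs ler].
- case/mapP=> s /suffixes0P[i _ ->] ->; split=> [|t].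
    by apply/leq_sizeP => t ltt; rewrite !coefD !coefXnz coef_ivl; lia.
  by rewrite !coefD !coefXnz coef_ivl; lia.
- case/mapP=> s /suffixes0P[i _ ->] ->; split=> [|t].
    by apply/leq_sizeP => t ltt; rewrite !coefD !coefXnz coef_ivl; lia.
  by rewrite !coefD !coefXnz coef_ivl; lia.
case/intervalsP=> i [k [ltik ->]]; split=> [|t]; last by rewrite coef_ivl; lia.
by apply: leq_trans (size_ivl _ _) _; lia.
Qed.

Lemma posrootDE r (a : rootvec r.+2) :
  posrootD a =
    (rootpoly a \in
       (rootsD_both r ++ rootsD_left r) ++ rootsD_right r ++ intervals r).
Proof.
have inL x : x \in (rootsD_both r ++ rootsD_left r) ++ rootsD_right r ++ intervals r ->
    (forall t : 'I_r.+2, (a t)%:Z = x`_t) ->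
    rootpoly a \in (rootsD_both r ++ rootsD_left r) ++ rootsD_right r ++ intervals r.
  move=> xL aE; suff /eqP-> : rootpoly a == x by [].
  rewrite eq_rootpoly; last by case: (rootsD_bounds _ _ xL).
  by apply/forallP=> t; rewrite aE.
have memB s : s \in suffixes r ++ hooks r -> s + ('X^r + 'X^(r.+1)) \in rootsD_both r.
  exact: (map_f (fun s => s + ('X^r + 'X^(r.+1)))).
have memL i : (i <= r)%N -> ivl r i + 'X^r \in rootsD_left r.
  by move=> lei; apply: (map_f (fun s => s + 'X^r)); apply/suffixes0P; exists i.
have memR i : (i <= r)%N -> ivl r i + 'X^(r.+1) \in rootsD_right r.
  by move=> lei; apply: (map_f (fun s => s + 'X^(r.+1))); apply/suffixes0P; exists i.
rewrite /posrootD subn1 subn2 !succnK; apply/idP/idP.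
  case/or4P=> [||| /orP[]].
  - case/existsP=> i /existsP[j /andP[leij /forallP aE]].
    (* A root of this family ending at index [r] contains alpha_(r+1); any other is an interval of
       alpha_1, ..., alpha_r. *)
    have [jr|jr] := eqVneq (j : nat) r.
      apply: (inL (ivl r i + 'X^r)) => [|t].
        by rewrite !mem_cat memL ?orbT //; case/andP: leij => + _; rewrite jr.
      by rewrite (eqP (aE t)) coefD coef_ivl coefXnz; lia.
    apply: (inL (ivl j.+1 i)) => [|t].
      rewrite !mem_cat; apply/orP; right; apply/orP; right.
      by apply/intervalsP; exists i, j.+1; split=> //; lia.
    by rewrite (eqP (aE t)) coef_ivl ltnS.
  - move/forallP=> aE; apply: (inL (ivl r r + 'X^(r.+1))) => [|t].
      by rewrite !mem_cat memR ?orbT.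
    by rewrite (eqP (aE t)) coefD coef_ivl coefXnz; lia.
  - case/existsP=> i /andP[lti /forallP aE].
    apply: (inL (ivl r i + 'X^(r.+1))) => [|t].
      by rewrite !mem_cat memR ?orbT // ltnW.
    by rewrite (eqP (aE t)) coefD coef_ivl coefXnz; lia.
  - case/existsP=> i /andP[lti /forallP aE].
    apply: (inL (ivl r i + ('X^r + 'X^(r.+1)))) => [|t].
      rewrite !mem_cat memB // mem_cat; apply/orP; left.
      by apply/suffixesP; exists i.
    by rewrite (eqP (aE t)) !coefD coef_ivl !coefXnz; have := ltn_ord t; lia.
  - case/existsP=> i /existsP[j /andP[ltij /forallP aE]].
    apply: (inL (ivl r i + ivl r j + ('X^r + 'X^(r.+1)))) => [|t].
      rewrite !mem_cat memB // mem_cat; apply/orP; right.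
      by apply/hooksP; exists i, j.
    by rewrite (eqP (aE t)) !coefD !coef_ivl !coefXnz; have := ltn_ord t; lia.
have coefa x (t : 'I_r.+2) : rootpoly a = x -> (a t)%:Z = x`_t.
  by move=> <-; rewrite coef_rootpoly.
rewrite !mem_cat -orbA => /or4P[].
- case/mapP=> s; rewrite mem_cat => /orP[/suffixesP[i lti ->]|/hooksP[i [j [ltij ->]]]] aE.
    have lti' : (i < r.+2)%N by lia.
    apply/or4P/Or44/orP; left; apply/existsP; exists (Ordinal lti'); rewrite lti.
    apply/forallP=> t; have := coefa _ t aE.
    by rewrite !coefD coef_ivl !coefXnz /=; have := ltn_ord t; lia.
  have lti' : (i < r.+2)%N by lia.
  have ltj' : (j < r.+2)%N by lia.
  apply/or4P/Or44/orP; right; apply/existsP; exists (Ordinal lti').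
  apply/existsP; exists (Ordinal ltj'); rewrite ltij.
  apply/forallP=> t; have := coefa _ t aE.
  by rewrite !coefD !coef_ivl !coefXnz /=; have := ltn_ord t; lia.
- case/mapP=> s /suffixes0P[i lei ->] aE.
  have lti' : (i < r.+2)%N by lia.
  apply/or4P/Or41/existsP; exists (Ordinal lti').
  apply/existsP; exists (Ordinal (leqnSn r.+1)); rewrite /= lei ltnSn.
  apply/forallP=> t; have := coefa _ t aE.
  by rewrite !coefD !coef_ivl !coefXnz /=; have := ltn_ord t; lia.
(* For [i = r] the suffix is zero and the root is alpha_(r+2) alone, a separate clause of
   [posrootD]. *)
- case/mapP=> s /suffixes0P[i lei ->] aE; have [ir|ir] := eqVneq i r.
    apply/or4P/Or42/forallP=> t; have := coefa _ t aE.
    by rewrite !coefD !coef_ivl !coefXnz /=; have := ltn_ord t; lia.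
  have lti' : (i < r.+2)%N by lia.
  apply/or4P/Or43/existsP; exists (Ordinal lti').
  apply/andP; split; first by rewrite /=; lia.
  apply/forallP=> t; have := coefa _ t aE.
  by rewrite !coefD !coef_ivl !coefXnz /=; have := ltn_ord t; lia.
case/intervalsP=> i [k [ltik aE]].
have lti' : (i < r.+2)%N by lia.
have ltk' : (k.-1 < r.+2)%N by lia.
apply/or4P/Or41/existsP; exists (Ordinal lti').
apply/existsP; exists (Ordinal ltk'); apply/andP; split; first by rewrite /=; lia.
apply/forallP=> t; have := coefa _ t aE.
by rewrite coef_ivl /=; have := ltn_ord t; lia.
Qed.

Lemma coef_topD r (t : 'I_r.+2) : (topD r)`_t = (highestD t)%:Z.
Proof.
rewrite /highestD subn2 /= !coefD coef_topB !coefXnz.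
by have := ltn_ord t; case: t => t /=; lia.
Qed.

Lemma PDE r : PD r.+2 =
  partgen 3 ((rootsD_both r ++ rootsD_left r) ++ rootsD_right r ++ intervals r) (topD r).
Proof.
apply: partition_polyE.
- by move=> a; apply: posrootD_neq0.
- by move=> t; rewrite /highestD; case: (0 < t < _)%N.
- by apply/leq_sizeP => t ltt; rewrite !coefD coef_topB !coefXnz; lia.
- exact: coef_topD.
- exact: rootsD_uniq.
- exact: rootsD_bounds.
- exact: posrootDE.
Qed.

(** Both end coordinates of the highest root are 1. Coordinate [r] forces exactly one part from the
    first two lists; coordinate [r.+1] then forces one from [rootsD_right] precisely when that part
    misses alpha_(r+2). *)
Lemma PD_intervals r (N := partgen 3 (intervals r)) : PD r.+2 =
  'X * (\sum_(s <- suffixes r ++ hooks r) N (topB r - s) +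
        'X * \sum_(s <- 0 :: suffixes r) \sum_(s' <- 0 :: suffixes r) N (topB r - s - s')).
Proof.
have I0 t : (r <= t)%N -> {in intervals r, forall x, coefp t x = 0}.
  by move=> ler x xI; rewrite /= (intervals_coef_ge r).
rewrite PDE (@partgen_cat_one _ (coefp r)); first last.
- by rewrite /= !coefD coef_topB !coefXnz; lia.
- move=> x; rewrite mem_cat => /orP[/rootsD_right_coef[]//|]; exact: I0.
- by move=> x; rewrite mem_cat => /orP[/rootsD_both_coef[]|/rootsD_left_coef[]].
congr ('X * _); rewrite big_cat !big_map; congr (_ + _).
  rewrite [LHS]big_seq [RHS]big_seq; apply: eq_bigr => s sP.
  have szs : (size s <= r)%N.
    move: sP; rewrite mem_cat => /orP[sP|/size_hooks//].
    by apply: size_suffixes; rewrite inE sP orbT.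
  rewrite opprD addrACA subrr addr0 (@partgen_cat_none _ (coefp r.+1)) //.
  - by move=> x /rootsD_right_coef[].
  - exact: I0.
  - by rewrite /= coefB coef_topB nth_default ?(leqW szs) //; lia.
rewrite big_distrr [LHS]big_seq [RHS]big_seq; apply: eq_bigr => s /suffixes0P[i lei ->].
rewrite (@partgen_cat_one _ (coefp r.+1)); first last.
- by rewrite /= !coefB !coefD !coefXnz coef_topB coef_ivl; lia.
- exact: I0.
- by move=> x /rootsD_right_coef[].
congr ('X * _); rewrite big_map; apply: eq_bigr => s' _.
by congr (partgen _ _ _); rewrite /topD; ring.
Qed.

(** * The diagonal correction and the final identity *)

Lemma partgen_intervals_support n i (b : {poly int}) : (i <= n)%N ->
    (forall t, (i <= t)%N -> b`_t = 0) ->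
  partgen 3 (intervals n) b = partgen 3 (intervals i) b.
Proof.
move=> + b0; elim: n => [|n IHn]; first by rewrite leqn0 => /eqP->.
rewrite leq_eqVlt => /predU1P[->//|lein]; rewrite -IHn // intervalsS.
rewrite (@partgen_cat_none _ (coefp n)) //.
- by move=> x /suffixes_coef_last.
- by move=> x xI; rewrite /= (intervals_coef_ge n).
- by rewrite /= b0.
Qed.

Lemma partgen_intervals_diagonal r :
  \sum_(s <- suffixes r.+1) partgen 3 (intervals r) (topB r.+1 - s *+ 2)
    = \sum_(1 <= i < r.+1) PBNH i.
Proof.
rewrite big_map -[iota 0 _]/(index_iota 0 r.+1) big_nat_recl // big_add1 /=.
(* Twice the full suffix overshoots: coordinate 0 becomes 1 - 2, so the term of index 0 vanishes. *)
rewrite (@partgen_lt0 _ (coefp 0)) ?add0r => [||]; last first.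
- by rewrite /= coefB coefMn coef_topB coef_ivl.
- by move=> x /intervalsP[i [k [ltik ->]]]; rewrite /= coef_ivl.
apply: eq_big_nat => i lti; rewrite PBNHE.
(* Removing a suffix twice cancels every coefficient from its start on and leaves the highest root
   of a smaller B. *)
have -> : topB r.+1 - ivl r.+1 i.+1 *+ 2 = topB i.+1.
  by apply/polyP=> t; rewrite coefB coefMn !coef_topB coef_ivl; lia.
by apply: partgen_intervals_support => // t leit; rewrite coef_topB; lia.
Qed.

Theorem theorem5p2 (r : nat) (hr : (2 <= r)%N) :
  PD (r + 2)%N =
    PBH r + 'X^2 * PBNH r +
    (2 * 'X + 2) * (2 * PBNH r - 'X^2 * \sum_(1 <= i < r) PBNH i).
Proof.
case: r hr => [//|r hr]; rewrite addn2 PD_intervals.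
(* With the rank now [r.+1], the last coordinate has index [r]. The highest root has value 2 there
   because [hr] makes [r] positive, so a partition into intervals uses exactly two suffixes. *)
have S1 : {in suffixes r.+1, forall x, coefp r x = 1} by move=> x /suffixes_coef_last.
have I0 : {in intervals r, forall x, coefp r x = 0}.
  by move=> x xI; rewrite /= (intervals_coef_ge r).
have top2 : coefp r (topB r.+1) = 2 by rewrite /= coef_topB; lia.
(* Once two suffixes are removed, no part can reach the last node, so [intervals r] suffices. *)
pose M s s' := partgen 3 (intervals r) (topB r.+1 - s - s').
pose S := \sum_(s <- suffixes r.+1) \sum_(s' <- suffixes r.+1) M s s'.
have one : \sum_(s <- suffixes r.+1) partgen 3 (intervals r.+1) (topB r.+1 - s) = 'X * S.
  rewrite big_distrr [LHS]big_seq [RHS]big_seq; apply: eq_bigr => s sS.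
  rewrite intervalsS (partgen_cat_one S1 I0) //.
  by move: top2 (S1 s sS) => /= t2 s1; rewrite coefB t2 s1.
have two : \sum_(s <- suffixes r.+1) \sum_(s' <- suffixes r.+1)
    partgen 3 (intervals r.+1) (topB r.+1 - s - s') = S.
  rewrite [LHS]big_seq [RHS]big_seq; apply: eq_bigr => s sS.
  rewrite [LHS]big_seq [RHS]big_seq; apply: eq_bigr => s' s'S.
  rewrite intervalsS (partgen_cat_none S1 I0) //.
  by move: top2 (S1 s sS) (S1 s' s'S) => /= t2 s1 s1'; rewrite !coefB t2 s1 s1'.
have hooked : PBH r.+1 =
    'X * \sum_(s <- hooks r.+1) partgen 3 (intervals r.+1) (topB r.+1 - s).
  apply: (addIr (PBNH r.+1)); rewrite PBHE PBNHE addrC.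
  (* A hook uses up the whole last coordinate 2 of the highest root, so at most one hook occurs. *)
  apply: (@partgen_cat_once _ (coefp r) 2) => //; last by move: top2 => /= ->.
    by move=> x /hooks_coef_last.
  by move=> x /intervalsP[i [k [_ ->]]]; rewrite /= coef_ivl.
have doubled : 2 * PBNH r.+1 - 'X^2 * \sum_(1 <= i < r.+1) PBNH i = 'X^2 * S.
  rewrite PBNHE intervalsS (partgen_cat_two S1 I0 top2).
  by rewrite partgen_intervals_diagonal mulrDr addrK.
have bordered : \sum_(s <- suffixes r.+1) \sum_(s' <- 0 :: suffixes r.+1)
    partgen 3 (intervals r.+1) (topB r.+1 - s - s') = 'X * S + S.
  rewrite -one -two -big_split; apply: eq_bigr => s _.
  by rewrite big_cons subr0.
rewrite doubled hooked PBNHE big_cat one.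
(* The parts containing one end node each give [PBNH] for two zero suffixes, ['X * S] for each
   choice of a single zero one, and [S] for none. The part containing both gives the hooked sum and
   one more ['X * S]. *)
rewrite ![\sum_(s <- 0 :: _) _]big_cons bordered !subr0 one /=.
by ring.
Qed.
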